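(* Let $p$ be an odd prime and write $p-1=2^n z$ with $z$ odd. If $m\in\mathbb{F}_p^*$ is a quadratic residue, there exists $r\in\mathcal{R}^{(n)}$ such that $$\left(m^{\frac{p-z}{2}}r\right)^2= m .$$ The square roots of $m$ are thus $\pm m^{\frac{p-z}{2}}r$, and $m^{\frac{p-z}{2}}r$ is a quadratic residue if and only if $r$ is a quadratic residue.
   Context: $\mathbb{F}_p^*=(\mathbb{Z}/p\mathbb{Z})^\times$; a quadratic residue is a square in $\mathbb{F}_p^*$. The sets $\mathcal{R}^{(k)}\subset\mathbb{F}_p^*$ are defined recursively by $\mathcal{R}^{(0)}=\{1\}$ and $\mathcal{R}^{(k+1)}=\{x\in\mathbb{F}_p^* : x^2\in\mathcal{R}^{(k)}\}$. *)

(* Defs.v *)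
From HB Require Import structures.
From mathcomp Require Import all_boot all_order all_algebra.

Set Implicit Arguments.
Unset Strict Implicit.
Unset Printing Implicit Defensive.

Import GRing.Theory.
Local Open Scope ring_scope.

(* Elements of the multiplicative group of the prime field 'F_p are represented
   as nonzero elements of 'F_p, so that the sign in "+/- x" makes sense. *)

Definition quadratic_residue (p : nat) (x : 'F_p) : Prop :=
  x != 0 /\ exists y : 'F_p, y != 0 /\ y ^+ 2 = x.

Fixpoint iter_roots (p k : nat) : {set 'F_p} :=
  if k is k'.+1 then [set x : 'F_p | (x != 0) && (x ^+ 2 \in iter_roots p k')]
  else [set 1].

(* Main.v *)
Require Import Defs.
From HB Require Import structures.
From mathcomp Require Import all_boot all_order all_algebra all_field.

(** Write [m = y ^+ 2].  As [p - z] is even, [m ^+ ((p - z) %/ 2)] is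
    [y ^+ (p - z)], which misses [y = y ^+ p] (Fermat) by the factor
    [r = y ^+ z].  This factor lies in the [n]-th set of iterated roots of
    unity because [r ^+ (2 ^ n) = y ^+ (p - 1) = 1]: by
    [iter_roots_expE], that set is the kernel of [x |-> x ^+ (2 ^ n)].
    The two square roots of [m] are opposite since ['F_p] is a field, and
    the last equivalence holds because [m ^+ ((p - z) %/ 2)] is itself a
    nonzero square, and multiplication by such an element preserves and
    reflects quadratic residuosity ([quadratic_residue_sqrM]). *)

Set Implicit Arguments.
Unset Strict Implicit.
Unset Printing Implicit Defensive.

Import GRing.Theory.
Local Open Scope ring_scope.

(** Each recursive step replaces [x] by [x ^+ 2], hence doubles the exponent;
    [0] is on neither side, since a power of [2] is a positive exponent. *)
Lemma iter_roots_expE (p k : nat) (x : 'F_p) :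
  (x \in iter_roots p k) = (x ^+ (2 ^ k) == 1).
Proof.
elim: k x => [|k IHk] x /=; first by rewrite inE expr1.
rewrite inE IHk -exprM -expnS; have [->|//] := eqVneq x 0.
by rewrite expr0n expn_eq0 eq_sym oner_eq0.
Qed.

(** Multiplying a square root by [a], or by [a^-1], passes from one side to
    the other. *)
Lemma quadratic_residue_sqrM (p : nat) (a x : 'F_p) : a != 0 ->
  quadratic_residue (a ^+ 2 * x) <-> quadratic_residue x.
Proof.
move=> a0; split=> -[].
  rewrite mulf_eq0 => /norP[_ x0] [y [y0 yE]]; split=> //.
  exists (a^-1 * y); split; first by rewrite mulf_neq0 ?invr_neq0.
  by rewrite exprMn yE exprVn mulKf ?expf_neq0.
move=> x0 [y [y0 yE]]; split; first by rewrite mulf_neq0 ?expf_neq0.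
by exists (a * y); rewrite mulf_neq0 // exprMn yE.
Qed.

Lemma Fermat_Fp (p : nat) (x : 'F_p) : prime p -> x ^+ p = x.
Proof. by move=> p_pr; have := expf_card x; rewrite card_Fp. Qed.

Theorem proposition3p2 (p n z : nat) (p_prime : prime p) (p_odd : odd p)
    (hpz : (p - 1 = 2 ^ n * z)%N) (z_odd : odd z)
    (m : 'F_p) (hm : quadratic_residue m) :
  (exists2 r : 'F_p, r \in iter_roots p n
     & (m ^+ ((p - z) %/ 2)%N * r) ^+ 2 = m)
  /\
  (forall r : 'F_p, r \in iter_roots p n ->
     (m ^+ ((p - z) %/ 2)%N * r) ^+ 2 = m ->
     (forall x : 'F_p, x ^+ 2 = m <->
        x = m ^+ ((p - z) %/ 2)%N * r \/ x = - (m ^+ ((p - z) %/ 2)%N * r))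
     /\
     (quadratic_residue (m ^+ ((p - z) %/ 2)%N * r) <-> quadratic_residue r)).
Proof.
case: hm => _ [y [y0 yE]].
have lt_zp : (z < p)%N.
  by rewrite -(subnK (prime_gt0 p_prime)) addn1 ltnS hpz leq_pmull ?expn_gt0.
have halfK : (2 * ((p - z) %/ 2) = p - z)%N.
  by rewrite mulnC divnK // dvdn2 oddB ?(ltnW lt_zp) // p_odd z_odd.
have yp1 : y ^+ (p - 1) = 1.
  apply: (mulfI y0); rewrite -exprS subn1 prednK ?prime_gt0 //.
  by rewrite Fermat_Fp // mulr1.
split.
  (* [y ^+ (p - z) * y ^+ z = y ^+ p = y] *)
  exists (y ^+ z); first by rewrite iter_roots_expE -exprM mulnC -hpz yp1.
  by rewrite -yE -exprM halfK -exprD subnK ?(ltnW lt_zp) // Fermat_Fp.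
move=> r _ sE; split=> [x|].
  rewrite -[X in _ = X <-> _]sE; split=> [/eqP|[]->]; rewrite ?sqrrN //.
  by rewrite eqf_sqr => /orP[]/eqP; [left | right].
by rewrite -yE exprAC; apply: quadratic_residue_sqrM; rewrite expf_neq0.
Qed.
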